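(* Let $G \leq \mathrm{Homeo}(\mathfrak{C})$ be a finitely generated simple vigorous group. Then $u(G) \geq 1$, where $u(G)$ is the uniform spread of $G$.
   Context: $\mathfrak{C}$ denotes Cantor space and $\mathrm{Homeo}(\mathfrak{C})$ its group of homeomorphisms, acting on the right. A group $G \leq \mathrm{Homeo}(\mathfrak{C})$ is vigorous if for every clopen subset $A$ of $\mathfrak{C}$ and all proper nonempty clopen subsets $B$ and $C$ of $A$ there exists $\gamma \in G$ such that $B\gamma \subseteq C$ and $\gamma$ fixes $\mathfrak{C} \setminus A$ pointwise. The uniform spread $u(G)$ of a group $G$ is the supremum over integers $k$ for which there exists $\sigma \in G$ such that for any nontrivial $\alpha_1, \dots, \alpha_k \in G$ there exists $\beta$ in the conjugacy class $\sigma^G$ such that $\langle \alpha_1, \beta \rangle = \dots = \langle \alpha_k, \beta \rangle = G$. *)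

(* Defs.v *)
From HB Require Import structures.
From mathcomp Require Import all_boot all_order all_algebra.
From mathcomp Require Import all_classical all_reals all_analysis.

Set Implicit Arguments.
Unset Strict Implicit.
Unset Printing Implicit Defensive.

Local Open Scope classical_set_scope.
Local Open Scope group_scope.

(* The inverse is a field, but it is determined by [homeo_fun] (see
   [homeo_eq]); equality of homeomorphisms is equality of functions. *)
Record homeo (T : topologicalType) := Homeo {
  homeo_fun :> T -> T;
  homeo_inv : T -> T;
  homeo_funK : cancel homeo_fun homeo_inv;
  homeo_invK : cancel homeo_inv homeo_fun;
  homeo_fun_cont : continuous homeo_fun;
  homeo_inv_cont : continuous homeo_inv }.

Section HomeoGroup.
Variable T : topologicalType.
Implicit Types f g h : homeo T.

Lemma homeo_eq f g : f =1 g -> f = g.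
Proof.
case: f g => [f f' fK f'K cf cf'] [g g' gK g'K cg cg'] /= /funext fg.
have f'g' : f' = g' by apply/funext => x; rewrite -{1}(g'K x) -fg fK.
by subst g g'; congr Homeo; exact: Prop_irrelevance.
Qed.

Definition homeo_id : homeo T :=
  @Homeo T id id (fun=> erefl) (fun=> erefl) (fun=> cvg_id) (fun=> cvg_id).

Lemma comp_cont (f g : T -> T) :
  continuous f -> continuous g -> continuous (g \o f).
Proof. by move=> cf cg x; apply: continuous_comp; [exact: cf|exact: cg]. Qed.

(* Homeomorphisms act on the right: the product [f * g] is "f, then g". *)
Definition homeo_mul f g : homeo T :=
  Homeo (can_comp (@homeo_funK _ g) (@homeo_funK _ f))
        (can_comp (@homeo_invK _ f) (@homeo_invK _ g))
        (comp_cont (@homeo_fun_cont _ f) (@homeo_fun_cont _ g))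
        (comp_cont (@homeo_inv_cont _ g) (@homeo_inv_cont _ f)).

Definition homeo_V f : homeo T :=
  Homeo (@homeo_invK _ f) (@homeo_funK _ f)
        (@homeo_inv_cont _ f) (@homeo_fun_cont _ f).

HB.instance Definition _ := gen_eqMixin (homeo T).
HB.instance Definition _ := gen_choiceMixin (homeo T).

Lemma homeo_mulA : associative homeo_mul.
Proof. by move=> f g h; exact: homeo_eq. Qed.

Lemma homeo_mul1 : left_id homeo_id homeo_mul.
Proof. by move=> f; exact: homeo_eq. Qed.

Lemma homeo_1mul : right_id homeo_id homeo_mul.
Proof. by move=> f; exact: homeo_eq. Qed.

Lemma homeo_mulV : left_inverse homeo_id homeo_V homeo_mul.
Proof. by move=> f; apply: homeo_eq => x; exact: homeo_invK. Qed.

Lemma homeo_Vmul : right_inverse homeo_id homeo_V homeo_mul.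
Proof. by move=> f; apply: homeo_eq => x; exact: homeo_funK. Qed.

HB.instance Definition _ := isGroup.Build (homeo T)
  homeo_mulA homeo_mul1 homeo_1mul homeo_mulV homeo_Vmul.

End HomeoGroup.

Section GroupNotions.
Variable gT : groupType.
Implicit Types (A G N : set gT) (s x : gT).

Definition is_subgroup G := group_closed (mem G).

Definition generated A : set gT := smallest is_subgroup A.

Definition finitely_generated G :=
  exists2 A : set gT, finite_set A & generated A = G.

Definition normal_subgroup N G :=
  [/\ is_subgroup N, N `<=` G & forall x g, N x -> G g -> N (x ^ g)].

Definition simple_group G :=
  G <> [set 1] /\
  forall N, normal_subgroup N G -> N = [set 1] \/ N = G.

Definition conj_class s G : set gT := [set s ^ g | g in G].

Definition uniform_spread_witness G (k : nat) :=
  exists2 s, G s &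
    forall a : 'I_k -> gT, (forall i, G (a i) /\ a i <> 1) ->
      exists2 b, conj_class s G b & forall i, generated [set a i; b] = G.

(* A supremum in the extended reals, equal to +oo if every k has a witness. *)
Definition uniform_spread (R : realType) G : \bar R :=
  ereal_sup [set (k%:R)%R%:E | k in uniform_spread_witness G].

End GroupNotions.

Definition vigorous (G : set (homeo cantor_space)) :=
  forall A B C : set cantor_space,
    clopen A -> clopen B -> clopen C ->
    B `<` A -> C `<` A -> B !=set0 -> C !=set0 ->
    exists2 g : homeo cantor_space, G g &
      g @` B `<=` C /\ forall x, (~` A) x -> g x = x.

(* Main.v *)
(* Elements of a simple vigorous group G agree on every proper clopen set with
   elements of G of prescribed support ([extend]), and therefore G contains
   elements of any finite order, and G is generated by the commutators of finitely
   many involutions u_i of proper support.  Fix s in G of odd order N whose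
   support Q is proper and is a disjoint union of translates s^i W.  A
   piecewise-G copy of the Cantor space onto a clopen set B, with W < B < W u sW
   and B meeting sW, carries the u_i to involutions x_i; the product t of the
   conjugates of the x_i by s^(2 * 3^i) is an involution, and since the positions
   2 * 3^i form a Sidon set, commutators of conjugates of t by powers of s are
   exactly the [x_i, x_j].  Hence <s, t> contains the elements of G whose support
   is a proper clopen subset of Q.

   Let P be the complement of Q and let g in G send P to a proper subset of Q
   containing the support of t.  The element sigma = t^(g^-1) s has powers
   t^(g^-1) and s.  Given a <> 1, conjugating a moves its action so that it agrees
   with g on P (first move P into a clopen set disjoint from its image under a,
   then correct the image by an element supported in Q); after this, t^(g^-1)
   conjugated by a is t, so <a, sigma> contains s and t.  Finally Q and
   a^-1 Q overlap and cover the Cantor space, whence <a, sigma> = G. *)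
Require Import Defs.
From mathcomp Require Import all_boot all_order all_algebra.
From mathcomp Require Import all_classical all_reals all_analysis.
From mathcomp Require Import zify.

Set Implicit Arguments.
Unset Strict Implicit.
Unset Printing Implicit Defensive.

Local Open Scope classical_set_scope.
Local Open Scope group_scope.

(** * Subgroups, generation and simplicity *)

Section Subgroups.
Variable gT : groupType.
Implicit Types (A G H : set gT) (x y g : gT).

Lemma subgroupP H : is_subgroup H <->
  [/\ H 1, forall x y, H x -> H y -> H (x * y) & forall x, H x -> H x^-1].
Proof.
split=> [[H1 HB]|[H1 HM HV]].
  move: H1; rewrite inE => H1.
  have HV x : H x -> H x^-1.
    by move=> Hx; have := HB 1 x; rewrite !inE mul1g; exact.
  split=> // x y Hx Hy; have := HB x y^-1; rewrite !inE invgK; apply=> //.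
  exact: HV.
split=> [|x y]; rewrite ?inE // => Hx Hy.
by apply: HM => //; exact: HV.
Qed.

Lemma subgroup1 H : is_subgroup H -> H 1.
Proof. by case/subgroupP. Qed.

Lemma subgroupM H x y : is_subgroup H -> H x -> H y -> H (x * y).
Proof. by case/subgroupP => _ HM _; exact: HM. Qed.

Lemma subgroupV H x : is_subgroup H -> H x -> H x^-1.
Proof. by case/subgroupP => _ _; exact. Qed.

Lemma subgroupJ H x y : is_subgroup H -> H x -> H y -> H (x ^ y).
Proof.
move=> sH Hx Hy; rewrite conjgE; apply: subgroupM => //.
  exact: subgroupV.
exact: subgroupM.
Qed.

Lemma subgroupR H x y : is_subgroup H -> H x -> H y -> H [~ x, y].
Proof.
move=> sH Hx Hy; rewrite commgEl; apply: subgroupM => //.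
  exact: subgroupV.
exact: subgroupJ.
Qed.

Lemma subgroupX H x n : is_subgroup H -> H x -> H (x ^+ n).
Proof.
move=> sH Hx; elim: n => [|n IH]; first by rewrite expg0; exact: subgroup1.
by rewrite expgS; apply: subgroupM.
Qed.

Lemma subgroup_generated A : is_subgroup (generated A).
Proof.
apply/subgroupP; split=> [H [sH _]|x y Ax Ay H [sH AH]|x Ax H [sH AH]].
- exact: subgroup1.
- by apply: subgroupM => //; [exact: Ax|exact: Ay].
- by apply: subgroupV => //; exact: Ax.
Qed.

Lemma sub_generated A : A `<=` generated A.
Proof. by move=> x Ax H [_]; exact. Qed.

Lemma generated_sub A H : is_subgroup H -> A `<=` H -> generated A `<=` H.
Proof. by move=> sH AH x; apply. Qed.

Lemma generatedS A B : A `<=` B -> generated A `<=` generated B.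
Proof.
move=> AB; apply: generated_sub; first exact: subgroup_generated.
by move=> x /AB; exact: sub_generated.
Qed.

Lemma generatedJ A g : (forall x, A x -> A (x ^ g)) ->
  forall x, generated A x -> generated A (x ^ g).
Proof.
have sgA := subgroup_generated A.
move=> AJ; suff: generated A `<=` [set x | generated A (x ^ g)] by [].
refine (generated_sub _ _); last by move=> x /AJ; exact: sub_generated.
apply/subgroupP; split=> [|x y /= Hx Hy|x /= Hx].
- by rewrite /= conj1g; exact: (subgroup1 sgA).
- by rewrite conjMg; exact: (subgroupM sgA).
- by rewrite conjVg; exact: (subgroupV sgA).
Qed.

(** A conjugation-invariant set generates a normal subgroup, and the element [x] rules out the
    trivial one. *)
Lemma simple_generated G A :
  is_subgroup G -> simple_group G -> A `<=` G ->
  (forall x g, A x -> G g -> A (x ^ g)) -> (exists2 x, A x & x <> 1) ->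
  generated A = G.
Proof.
move=> sG [_ simG] AG AJ [x Ax x1].
case: (simG (generated A)) => //.
  split; [exact: subgroup_generated|exact: generated_sub|].
  move=> y g Ay Gg; apply: generatedJ => // z Az; exact: AJ.
move=> eA; have : [set 1] x by rewrite -eA; exact: sub_generated.
by move=> /= /x1.
Qed.

End Subgroups.

(** * Clopen subsets of the Cantor space *)

Section ClopenCantor.
Local Notation T := cantor_space.
Implicit Types (U V : set T) (x y z : T).

Lemma clopen_setC U : clopen U -> clopen (~` U).
Proof. exact: (clopenC U). Qed.

Lemma clopen_setD U V : clopen U -> clopen V -> clopen (U `\` V).
Proof. by move=> cU cV; rewrite setDE; apply: clopenI => //; exact: clopen_setC. Qed.

Lemma clopen_neq x y : x <> y -> exists U, [/\ clopen U, U x & ~ U y].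
Proof. by move=> /eqP; exact: cantor_zero_dimensional. Qed.

Lemma clopen_other U x : clopen U -> U x -> exists2 y, U y & y <> x.
Proof.
move=> cU Ux; have [_ lT] := cantor_perfect.
have : limit_point [set: T] x by rewrite lT.
move=> /(_ U); case; first by apply: open_nbhs_nbhs; split=> //; case: cU.
by move=> y [/eqP yx _ Uy]; exists y.
Qed.


(** No point of the Cantor space is isolated, so there is room for all these demands. The points
    left outside [O] serve as witnesses of properness when vigor is applied. *)
Lemma clopen_shrink U z : clopen U -> U !=set0 ->
  exists O, [/\ clopen O, O `<=` U, O !=set0, ~ O z & exists2 y, U y & ~ O y /\ y <> z].
Proof.
move=> cU [x0 Ux0].
have [x Ux xz] : exists2 x, U x & x <> z.
  case: (pselect (x0 = z)) => [xz|]; last by exists x0.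
  by have [x Ux] := clopen_other cU Ux0; rewrite xz; exists x.
have [V [cV Vx Vz]] := clopen_neq xz.
have cUV : clopen (U `&` V) by exact: clopenI.
have [y [Uy Vy] yx] := clopen_other cUV (conj Ux Vx).
have [W [cW Wx Wy]] := clopen_neq (nesym yx).
exists (U `&` V `&` W); split=> [||||].
- exact: clopenI.
- by move=> u [[]].
- by exists x.
- by case=> [[]].
- by exists y => //; split=> [[]//|yz]; apply: Vz; rewrite -yz.
Qed.

Lemma clopen_preim (g : homeo T) U : clopen U -> clopen (g @^-1` U).
Proof. by move=> cU; apply: preimage_clopen => //; exact: homeo_fun_cont. Qed.

End ClopenCantor.

Ltac clopen_tac := repeat first [assumption | exact: clopenT | apply: clopen_setD |
  apply: clopenI | apply: clopenU | apply: clopen_setC | apply: clopen_preim].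

(** * Supports and powers of homeomorphisms *)

Section Supports.
Variable T : topologicalType.
Implicit Types (A : set T) (f g : homeo T).

Lemma homeoKg f x : f^-1 (f x) = x.
Proof. exact: homeo_funK. Qed.

Lemma homeogK f x : f (f^-1 x) = x.
Proof. exact: homeo_invK. Qed.

Lemma homeoM f g x : (f * g) x = g (f x).
Proof. by []. Qed.

Lemma homeo_inj f : injective f.
Proof. exact: can_inj (homeoKg f). Qed.

Lemma homeoV_fix f x : f x = x -> f^-1 x = x.
Proof. by move=> fx; rewrite -{1}fx homeoKg. Qed.

Lemma mem_preim f A x : (f @^-1` A) x = A (f x).
Proof. by []. Qed.

Definition supported A f := forall x, ~ A x -> f x = x.

Lemma supportedM A f g : supported A f -> supported A g -> supported A (f * g).
Proof. by move=> fA gA x Ax; rewrite homeoM fA // gA. Qed.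

Lemma supportedV A f : supported A f -> supported A f^-1.
Proof. by move=> fA x Ax; apply: homeoV_fix; exact: fA. Qed.

Lemma supportedJ A f g : supported (g @^-1` A) f -> supported A (f ^ g).
Proof.
move=> fA x Ax; rewrite conjgE !homeoM fA ?homeogK //.
by rewrite !mem_preim homeogK.
Qed.

Lemma supported_mem A f x : supported A f -> A x -> A (f x).
Proof.
move=> fA Ax; apply: contrapT => Afx; apply: (Afx).
by rewrite (homeo_inj (fA _ Afx)).
Qed.

Lemma supported_memV A f x : supported A f -> A x -> A (f^-1 x).
Proof. by move=> /supportedV; exact: supported_mem. Qed.

Lemma homeoJ f g x : (f ^ g) x = g (f (g^-1 x)).
Proof. by rewrite conjgE. Qed.

Lemma homeo1 x : (1 : homeo T) x = x.
Proof. by []. Qed.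

Lemma homeoXS f n x : (f ^+ n.+1) x = f ((f ^+ n) x).
Proof. by rewrite expgSr. Qed.

Lemma homeoXSr f n x : (f ^+ n.+1) x = (f ^+ n) (f x).
Proof. by rewrite expgS. Qed.

Lemma homeoXD f m n x : (f ^+ (m + n)%N) x = (f ^+ m) ((f ^+ n) x).
Proof. by rewrite addnC expgnDr. Qed.

Lemma homeoX_semiconj A f g (phi : T -> T) : (forall y, A y -> A (f y)) ->
  (forall y, A y -> g (phi y) = phi (f y)) ->
  forall n y, A y -> A ((f ^+ n) y) /\ (g ^+ n) (phi y) = phi ((f ^+ n) y).
Proof.
move=> fA gphi; elim=> [|n IH] y Ay; first by rewrite !expg0.
have [Afy gy] := IH y Ay; rewrite !homeoXS gy gphi //; split=> //; exact: fA.
Qed.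

Lemma homeoX_mem A f n y : (forall y, A y -> A (f y)) -> A y -> A ((f ^+ n) y).
Proof.
move=> fA Ay.
by have [] := homeoX_semiconj (phi := id) (g := f) fA (fun _ _ => erefl) n Ay.
Qed.

Lemma homeoXK f n x : (f^-1 ^+ n) ((f ^+ n) x) = x.
Proof.
by elim: n x => [|n IH] x //; rewrite (homeoXS f^-1) (homeoXSr f) IH homeoKg.
Qed.

Lemma homeoXVK f n x : (f ^+ n) ((f^-1 ^+ n) x) = x.
Proof. by rewrite -{1}(invgK f) homeoXK. Qed.

Lemma clopen_bounded (F : nat -> set T) n : (forall i, clopen (F i)) ->
  clopen [set x | exists2 i, (i < n)%N & F i x].
Proof.
move=> cF; elim: n => [|n IH].
  rewrite (_ : [set x | _] = set0); first exact: clopen0.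
  by apply/seteqP; split=> x // -[].
rewrite (_ : [set x | _] = [set x | exists2 i, (i < n)%N & F i x] `|` F n).
  exact: clopenU.
apply/seteqP; split=> x.
  move=> [i]; rewrite ltnS leq_eqVlt => /predU1P[->|ltin] Fx; first by right.
  by left; exists i.
by case=> [[i ltin Fx]|Fx]; [exists i => //; exact: ltnW|exists n].
Qed.

End Supports.

(** * Vigorous groups *)

Section Vigorous.
Local Notation T := cantor_space.
Variable G : set (homeo T).
Hypotheses (sG : is_subgroup G) (simG : simple_group G) (vigG : vigorous G).
Implicit Types (A B C D M U V : set T) (x y z : T) (f g h : homeo T).

(** Vigor with properness given by points and with [B] allowed to be empty, in which case the
    identity serves. *)
Lemma vigorousP A B C : clopen A -> clopen B -> clopen C ->
  B `<=` A -> C `<=` A -> (exists2 x, A x & ~ B x) -> (exists2 x, A x & ~ C x) ->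
  C !=set0 ->
  exists2 g, G g & supported A g /\ forall x, B x -> C (g x).
Proof.
move=> cA cB cC BA CA [b Ab Bb] [c Ac Cc] C0.
case: (pselect (B !=set0)) => [B0|B0]; last first.
  exists 1; first exact: subgroup1.
  by split=> // x Bx; case: B0; exists x.
have pBA : B `<` A by split=> // /(_ _ Ab).
have pCA : C `<` A by split=> // /(_ _ Ac).
have [g Gg [gBC gA]] := vigG cA cB cC pBA pCA B0 C0.
by exists g => //; split=> // x Bx; apply: gBC; exists x.
Qed.

Lemma clopen_split U : clopen U -> U !=set0 ->
  exists V W, [/\ [/\ clopen V, clopen W & V `&` W `<=` set0],
    V `<=` U, W `<=` U, V !=set0 & W !=set0].
Proof.
move=> cU U0; have [x Ux] := U0.
have [V [cV VU V0 Vx _]] := clopen_shrink x cU U0.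
exists V, (U `\` V); split=> //; last by exists x.
by split; [|exact: clopen_setD|move=> y [Vy []]].
Qed.

Definition small_support g := exists A y, [/\ clopen A, ~ A y & supported A g].

Lemma small_supportJ f g : small_support f -> small_support (f ^ g).
Proof.
move=> [A [y [cA Ay fA]]]; exists ((g^-1)%g @^-1` A), (g y); split.
- exact: clopen_preim.
- by rewrite mem_preim homeoKg.
- apply: supportedJ => z Az; apply: fA => Azz; apply: Az.
  by rewrite !mem_preim homeoKg.
Qed.

(** Elements of small support form a conjugation-invariant set. It has a nontrivial member: inside a
    proper clopen set, vigor moves one piece into a disjoint one. Simplicity does the rest. *)
Lemma small_support_generate H : is_subgroup H ->
  (forall g, G g -> small_support g -> H g) -> G `<=` H.
Proof.
move=> sH GH; rewrite -(@simple_generated _ G [set g | G g /\ small_support g]) //.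
- by refine (generated_sub sH _) => g [Gg gs]; exact: GH.
- by move=> x [].
- by move=> x g [Gx xs] Gg; split; [exact: subgroupJ|exact: small_supportJ].
- have [|A [B [[cA cB AB] _ _ A0 [b Bb]]]] := clopen_split (@clopenT T).
    by exists point.
  have [V [W [[cV cW VW] VA WA [v Vv] [w Ww]]]] := clopen_split cA A0.
  have [|||g Gg [gA gVW]] := vigorousP cA cV cW VA WA.
  - by exists w => [|Vw]; [exact: WA|exact: (VW w)].
  - by exists v => [|Wv]; [exact: VA|exact: (VW v)].
  - by exists w.
  exists g.
    by split=> //; exists A, b; split=> // Ab; exact: (AB b).
  by move=> g1; apply: (VW v); split=> //; have := gVW v Vv; rewrite g1.
Qed.

(** * Extending partial maps by elements of prescribed support *)

(* [h] is the commutator of an element moving [D] into [R] with [g], in which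
   the copy of [g^-1] in the middle acts trivially on the displaced [D]. *)
Lemma localize g D R M : G g -> clopen D -> clopen R -> R !=set0 ->
  (forall x, D x -> R x -> False) -> (forall x, R x -> g x = x) ->
  D `<=` M -> R `<=` M -> (forall x, D x -> M (g x)) ->
  exists h, [/\ G h, supported M h & forall x, D x -> h x = g x].
Proof.
move=> Gg cD cR [r Rr] DR gR DM RM gDM.
case: (pselect (D !=set0)) => [[d Dd]|D0]; last first.
  exists 1; split=> //; first exact: subgroup1.
  by move=> x Dx; case: D0; exists x.
have cDR : clopen (D `|` R) by clopen_tac.
have [|||||k Gk [kDR kR]] := vigorousP cDR cD cR.
- by move=> x; left.
- by move=> x; right.
- by exists r; [right|move=> Dr; exact: (DR r)].
- by exists d; [left|move=> Rd; exact: (DR d)].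
- by exists r.
exists (k * g^-1 * k^-1 * g); split.
- by do !apply: subgroupM => //; exact: subgroupV.
- move=> x Mx; have DRx : ~ (D `|` R) x by case=> [/DM|/RM].
  rewrite !homeoM kDR // (supportedV kDR) ?homeogK // => -[Dx|Rx].
    by apply: Mx; rewrite -(homeogK g x); exact: gDM.
  by apply: DRx; right; rewrite -(homeogK g x) gR.
- by move=> x Dx; rewrite !homeoM (homeoV_fix (gR _ (kR _ Dx))) homeoKg.
Qed.

(** The preimage of [M] under [w] contains [y] besides [x] and [z]. An element supported there
    becomes, after conjugation by [w], supported in [M], with its germ at [x] unchanged if it sends
    [x] to [z]. *)
Lemma move_into M x y z : clopen M -> M x -> M z ->
  exists w p, [/\ G w, clopen p, p x, p z & (forall u, p u -> w u = u) /\ M (w y)].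
Proof.
move=> cM Mx Mz; case: (pselect (M y)) => [My|My].
  by exists 1, M; split=> //; exact: subgroup1.
have [ O1 [cO1 O1M O10 O1x _]] := clopen_shrink x cM (ex_intro _ x Mx).
have [ O [cO OO1 O0 Oz _]] := clopen_shrink z cO1 O10.
have OM : O `<=` M by exact: subset_trans OO1 O1M.
have [ o Oo] := O0.
have cA : clopen (~` (M `\` O)) by clopen_tac.
have [||||| w Gw [wA wO]] := vigorousP cA (clopen_setC cM) cO.
- by move=> u Mu [].
- by move=> u Ou [].
- by exists o => [[]|Mo] //; apply: Mo; exact: OM.
- by exists y => [[]|/OM].
- exact: O0.
exists w, (M `\` O); split=> //; first by clopen_tac.
- by split=> // /OO1.
split=> [u Mu|]; last by apply/OM/wO.
by apply: wA => /(_ Mu).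
Qed.

Definition germs_extend g := forall M x, clopen M -> M x -> M (g x) ->
  exists h p, [/\ G h, supported M h, clopen p, p x & forall y, p y -> h y = g y].

Lemma subgroup_germs_extend : is_subgroup [set g | germs_extend g].
Proof.
apply/subgroupP; split=> [M x cM Mx _|f g ef eg M x cM Mx Mgx|g eg M x cM Mx Mgx].
- by exists 1, M; split=> //; exact: subgroup1.
- have [w [p [Gw cp px pgx [wp Mw]]]] := move_into (f x) cM Mx Mgx.
  have cM' : clopen (w @^-1` M) by clopen_tac.
  have [||h1 [p1 [Gh1 h1M cp1 p1x h1p]]] := ef _ x cM'.
  - by rewrite mem_preim wp.
  - exact: Mw.
  have [|h2 [p2 [Gh2 h2M cp2 p2x h2p]]] := eg _ (f x) cM' Mw.
    by rewrite mem_preim wp.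
  exists ((h1 * h2) ^ w), (p `&` p1 `&` f @^-1` p2 `&` (f * g)%g @^-1` p).
  split=> //; [|by apply: supportedJ; exact: supportedM|by clopen_tac|].
    by apply: subgroupJ => //; exact: subgroupM.
  move=> y [[[py p1y] p2y] pgy].
  by rewrite homeoJ (homeoV_fix (wp _ py)) homeoM h1p // h2p // wp.
- have [||h [p [Gh hM cp px hp]]] := eg M (g^-1 x) cM.
  - by [].
  - by rewrite homeogK.
  exists h^-1, ((g^-1)%g @^-1` p); split=> //; [exact: subgroupV| |clopen_tac|].
    exact: supportedV.
  by move=> y py; apply: (@homeo_inj _ h); rewrite homeogK hp // homeogK.
Qed.

(** It suffices to treat [g] of small support. Such a [g] fixes a neighbourhood of some point [y];
    once [w] has brought [y] into [M], this neighbourhood provides the region of fixed points that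
    [localize] requires. *)
Lemma germ_extend g : G g -> germs_extend g.
Proof.
apply: (small_support_generate subgroup_germs_extend).
move=> {}g Gg [A [y [cA Ay gA]]] M x cM Mx Mgx.
case: (pselect (A x)) => [Ax|Ax]; last first.
  exists 1, (~` A); split=> //; [exact: subgroup1|clopen_tac|].
  by move=> z Az; rewrite gA.
have [w [p [Gw cp px pgx [wp Mw]]]] := move_into y cM Mx Mgx.
pose M' := w @^-1` M; pose D := A `&` M' `&` g @^-1` M'.
have cM' : clopen M' by clopen_tac.
have cD : clopen D by rewrite /D; clopen_tac.
have cR : clopen (M' `\` A) by clopen_tac.
have [||||||h [Gh hM hD]] := @localize g D (M' `\` A) M' Gg cD cR.
- by exists y.
- by move=> u [[Au _] _] [_].
- by move=> u [_ Au]; exact: gA.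
- by move=> u [[]].
- by move=> u [].
- by move=> u [].
exists (h ^ w), (D `&` p `&` g @^-1` p); split=> //.
- exact: subgroupJ.
- exact: supportedJ.
- by clopen_tac.
- have M'x : M' x by rewrite /M' mem_preim wp.
  by have M'gx : M' (g x) by rewrite /M' mem_preim wp.
- by move=> u [[Du pu] pgu]; rewrite homeoJ (homeoV_fix (wp _ pu)) hD // wp.
Qed.

Lemma extend g M D : G g -> clopen M -> clopen D ->
  D `<=` M -> (forall x, D x -> M (g x)) ->
  (exists2 z, M z & ~ D z) -> (exists2 z, M z & ~ D (g^-1 z)) ->
  exists h, [/\ G h, supported M h & forall x, D x -> h x = g x].
Proof.
move=> Gg cM cD DM gDM zD [z Mz gDz].
have step f E : G f -> clopen E -> E `<=` M -> (forall x, E x -> M (f x)) ->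
    (exists2 y, M y & ~ E y /\ ~ E (f^-1 y)) ->
    exists h, [/\ G h, supported M h & forall x, E x -> h x = f x].
  move=> Gf cE EM fEM [y My [Ey fEy]].
  (* The correction [d] undoes [f] near [f y] and is the identity on the image of [E]. So [f * d]
     still agrees with [f] on [E], and it fixes a neighbourhood of [y], as [localize] requires. *)
  have cM1 : clopen (~` ((f^-1)%g @^-1` E)) by clopen_tac.
  have [||d [p [Gd dM cp py dp]]] := germ_extend (subgroupV sG Gf) (x := f y) cM1.
  - by change (~ E (f^-1 (f y))); rewrite homeoKg.
  - by change (~ E (f^-1 (f^-1 (f y)))); rewrite homeoKg.
  have cR : clopen ((f @^-1` p) `&` (M `\` E)) by clopen_tac.
  have fdE x : E x -> (f * d) x = f x.
    by move=> Ex; rewrite homeoM dM //; apply; rewrite mem_preim homeoKg.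
  have [||||||h [Gh hM hE]] := @localize (f * d) E _ M (subgroupM sG Gf Gd) cE cR.
  - by exists y.
  - by move=> u Eu [_ []].
  - by move=> u [pu _]; rewrite homeoM dp // homeoKg.
  - by [].
  - by move=> u [_ []].
  - by move=> u Eu; rewrite fdE //; exact: fEM.
  by exists h; split=> // x Ex; rewrite hE // fdE.
(* [D] and its image under [g] may together cover [M]. Hence [D] is first moved by [v] into a small
   [O] off that image, and [step] is applied to [v^-1 * g], which leaves the point [y] free. *)
have cO1 : clopen (M `\` ((g^-1)%g @^-1` D)) by clopen_tac.
have [|O [cO OM O0 Oz [y [My gDy] [ Oy _]]]] := clopen_shrink z cO1.
  by exists z.
have [||||v Gv [vM vO]] := vigorousP cM cD cO DM.
- by move=> u /OM [].
- by [].
- by exists z.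
- exact: O0.
have [|||||h [Gh hM hE]] := step (v^-1 * g) ((v^-1)%g @^-1` D).
- by apply: subgroupM => //; exact: subgroupV.
- by clopen_tac.
- by move=> x /vO; rewrite homeogK => /OM [].
- by move=> x Dx; exact: gDM.
- exists y => //; split; first by move=> /vO; rewrite homeogK.
  by rewrite !mem_preim invgM invgK homeoM homeoKg.
exists (v * h); split; [exact: subgroupM|exact: supportedM|].
move=> x Dx; rewrite homeoM hE; first by rewrite homeoM homeoKg.
by rewrite mem_preim homeoKg.
Qed.

(** * Elements of finite order *)

Lemma wandering : exists g R E, [/\ G g, clopen R, R !=set0 & E !=set0] /\
  [/\ clopen E, forall x n, R x -> ~ E ((g ^+ n) x) &
    forall i j x y, R x -> R y -> (g ^+ i) x = (g ^+ j) y -> i = j].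
Proof.
have [|R [E0 [[cR cE0 RE0] _ _ R0 E00]]] := clopen_split (@clopenT T).
  by exists point.
have [E [F [[cE cF EF] EE FE [e Ee] [f Ff]]]] := clopen_split cE0 E00.
have [r Rr] := R0.
have [|||||g Gg [_ gF]] := vigorousP (@clopenT T) (clopen_setC cE) cF.
- by [].
- by [].
- by exists e => // /(_ Ee).
- by exists e => // Fe; exact: (EF e).
- by exists f.
have gRF n x : R x -> F ((g ^+ n.+1) x).
  move=> Rx; elim: n => [|n IH]; rewrite homeoXS; apply: gF.
    by rewrite expg0 homeo1 => /EE Ex; exact: (RE0 x).
  by move=> En; apply: (EF ((g ^+ n.+1) x)).
have neq i n x y : R x -> R y -> (g ^+ i) x = (g ^+ (i + n.+1)%N) y -> False.
  move=> Rx Ry; rewrite homeoXD => /homeo_inj xy; apply: (RE0 x); split=> //.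
  by apply: FE; rewrite xy; exact: gRF.
exists g, R, E; split; first by split=> //; exists e.
split=> // [x [|n] Rx Ex|i j x y Rx Ry xy].
- by apply: (RE0 x); split=> //; exact: EE.
- by apply: (EF ((g ^+ n.+1) x)); split=> //; exact: gRF.
- case: (ltngtP i j) => // lt; exfalso.
    by apply: (neq i (j - i.+1)%N x y) => //; rewrite addnS -addSn subnKC.
  by apply: (neq j (i - j.+1)%N y x) => //; rewrite addnS -addSn subnKC.
Qed.

(** The wandering [g] is followed by [d], which fixes the images of [R] under [g], ..., [g ^+ N] and
    returns the next one to [R] by [g ^+ N.+1] inverted. Nothing is claimed about [h] off [A]. *)
Lemma cycle_on N : exists h R A E,
  [/\ G h, [/\ clopen R, clopen A & clopen E], R !=set0, E !=set0 &
    A `&` E `<=` set0] /\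
  [/\ R `<=` A, forall x, A x -> A (h x), forall x, A x -> (h ^+ N.+1) x = x,
    forall x, A x -> exists i r, [/\ (i <= N)%N, R r & x = (h ^+ i) r] &
    forall i j x y, (i <= N)%N -> (j <= N)%N -> R x -> R y ->
      (h ^+ i) x = (h ^+ j) y -> i = j].
Proof.
have [g [R [E [[Gg cR R0 [e Ee]] [cE gE gR]]]]] := wandering.
have [r0 Rr0] := R0.
pose F i := ((g ^+ i)^-1)%g @^-1` R.
have cF i : clopen (F i) by clopen_tac.
have FE i x : F i x <-> exists2 r, R r & x = (g ^+ i) r.
  split=> [Fx|[r Rr ->]]; last by rewrite /F mem_preim homeoKg.
  by exists ((g ^+ i)^-1 x); rewrite ?homeogK.
pose A1 := [set x | exists2 i, (i < N)%N & F i.+1 x].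
have cA1 : clopen A1 by apply: (clopen_bounded (F := fun i => F i.+1)).
have Gv : G (g ^+ N.+1)^-1 by apply: subgroupV => //; exact: subgroupX.
have [||||d [Gd dM dF]] := extend Gv (clopen_setC cA1) (cF N.+1).
- move=> x /FE[r Rr ->] [i ltiN /FE[r' Rr' eq]].
  by have := gR _ _ _ _ Rr Rr' eq; lia.
- move=> x Fx [i ltiN /FE[r' Rr' eq]].
  by have := gR 0%N _ _ _ Fx Rr' eq; lia.
- exists r0.
    by move=> [i ltiN /FE[r' Rr' eq]]; have := gR 0%N _ _ _ Rr0 Rr' eq; lia.
  by move=> /FE[r' Rr' eq]; have := gR 0%N _ _ _ Rr0 Rr' eq; lia.
- exists e.
    by move=> [i ltiN /FE[r' Rr' eq]]; apply: (gE r' i.+1); rewrite -?eq.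
  rewrite /F mem_preim invgK homeoKg => Re.
  by apply: (gE e 0%N).
pose h := g * d.
have hX i r : (i <= N)%N -> R r -> (h ^+ i) r = (g ^+ i) r.
  move=> + Rr; elim: i => // i IH ltiN; rewrite homeoXS IH ?(ltnW ltiN) //.
  rewrite homeoM -homeoXS dM // => nA; apply: nA; exists i => //.
  by apply/FE; exists r.
have hN r : R r -> (h ^+ N.+1) r = r.
  move=> Rr; rewrite homeoXS hX // homeoM -homeoXS dF ?homeoKg //.
  by apply/FE; exists r.
pose A := [set x | exists2 i, (i < N.+1)%N & F i x].
have AE x : A x <-> exists i r, [/\ (i <= N)%N, R r & x = (h ^+ i) r].
  split=> [[i leiN /FE[r Rr ->]]|[i [r [leiN Rr ->]]]].
    by exists i, r; split=> //; rewrite hX.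
  by exists i => //; apply/FE; exists r => //; rewrite hX.
exists h, R, A, E; split; first split=> //.
- exact: subgroupM.
- by split=> //; exact: clopen_bounded.
- by exists e.
- move=> x [/AE[i [r [leiN Rr ->]]]]; rewrite hX //; exact: gE.
split=> [x Rx|x /AE[i [r [leiN Rr ->]]]|x /AE[i [r [leiN Rr ->]]]|x /AE//|].
- by apply/AE; exists 0%N, x.
- apply/AE; case: (ltnP i N) => [ltiN|leNi].
    by exists i.+1, r; rewrite homeoXS.
  have -> : i = N by lia.
  by exists 0%N, r; rewrite -homeoXS hN.
- by rewrite -homeoXD addnC homeoXD hN.
- move=> i j x y leiN lejN Rx Ry; rewrite !hX //; exact: gR.
Qed.

(** The map of [cycle_on] is periodic only on [A]. A second copy of [A], carrying the inverse map,
    is used to cancel the uncontrolled part. *)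
Lemma cycle N : exists s W Q,
  [/\ G s, s ^+ N.+1 = 1, clopen W, W !=set0 & clopen Q] /\
  [/\ supported Q s, (exists z, ~ Q z), W `<=` Q,
    forall x, Q x -> exists2 i, (i <= N.+1)%N & W ((s ^+ i) x) &
    forall i j x y, (i <= N)%N -> (j <= N)%N -> W x -> W y ->
      (s ^+ i) x = (s ^+ j) y -> i = j].
Proof.
have [h0 [R [A [E [[Gh0 [cR cA cE] [r Rr] [e0 Ee0] AE] [RA h0A h0N AR h0R]]]]]] :=
  cycle_on N.
have [E1 [cE1 E1E [e Ee] _ [e' Ee' [E1e' _]]]] :=
  clopen_shrink point cE (ex_intro _ _ Ee0).
have AE1 x : A x -> E1 x -> False by move=> Ax /E1E Ex; exact: (AE x).
have [||||h [Gh hM hh0]] := extend Gh0 (clopenU cA cE1) cA.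
- by move=> x; left.
- by move=> x /h0A; left.
- by exists e; [right|move=> Ae; exact: (AE1 e)].
- by exists e; [right|move=> /h0A; rewrite homeogK => Ae; exact: (AE1 e)].
have hA x : A x -> A (h x) by move=> Ax; rewrite hh0 //; exact: h0A.
have hX n x : A x -> A ((h0 ^+ n) x) /\ (h ^+ n) x = (h0 ^+ n) x.
  exact: (homeoX_semiconj (phi := id)).
have hVA x : A x -> A (h^-1 x).
  move=> Ax; have [+ _] := hX N x Ax; congr (A _).
  by apply: (@homeo_inj _ h); rewrite homeogK hh0 -?homeoXS ?h0N //; case: (hX N x Ax).
have hE1 x : E1 x -> E1 (h x).
  move=> Ex; have [|Ahx|//] := supported_mem hM (x := x); first by right.
  by exfalso; apply: (AE1 x) => //; rewrite -(homeoKg h x); exact: hVA.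
have [|||||k Gk [kE1 kA]] :=
  vigorousP (clopen_setC cE1) cA (clopen_setD cE cE1).
- by move=> x Ax E1x; exact: (AE1 x).
- by move=> x [].
- by exists e' => // Ae'; exact: (AE e').
- exists r; first by move=> /(AE1 r (RA r Rr)).
  by move=> [Er _]; exact: (AE r (conj (RA r Rr) Er)).
- by exists e'.
(* [h] is uncontrolled on [E1], but [k] is the identity there, so the two factors cancel. What
   remains is [h] on [A] and the conjugate of [h^-1] on the image of [A] under [k]. *)
pose s := h * (h^-1 ^ k).
have kfix x : E1 x -> k x = x by move=> E1x; apply: kE1 => /(_ E1x).
have kVfix x : E1 x -> k^-1 x = x by move=> E1x; exact/homeoV_fix/kfix.
have kVE1 x : ~ E1 x -> ~ E1 (k^-1 x).
  by move=> E1x E1k; apply: E1x; rewrite -(homeogK k x) kfix.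
have kVA x : A x -> ~ A (k^-1 x).
  move=> Ax /kA [Ex _]; rewrite homeogK in Ex; exact: (AE x).
have sA x : A x -> s x = h x.
  move=> /hA Ax; rewrite homeoM homeoJ (supportedV hM) ?homeogK // => -[|].
    exact: kVA.
  by apply: kVE1 => E1x; exact: (AE1 _ Ax).
have skA x : A x -> s (k x) = k (h^-1 x).
  move=> /kA[Ek E1k]; rewrite homeoM homeoJ hM ?homeoKg // => -[Ak|//].
  exact: (AE (k x)).
have soff x : ~ A x -> ~ A (k^-1 x) -> s x = x.
  move=> Ax Akx; rewrite homeoM homeoJ.
  case: (pselect (E1 x)) => E1x.
    by rewrite (kVfix _ (hE1 _ E1x)) homeoKg kfix.
  rewrite hM => [|[]//]; rewrite (supportedV hM) ?homeogK // => -[//|].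
  exact: kVE1.
have sXA n x : A x -> A ((h ^+ n) x) /\ (s ^+ n) x = (h ^+ n) x.
  exact: (homeoX_semiconj (phi := id)).
have sXkA n x : A x -> A ((h^-1 ^+ n) x) /\ (s ^+ n) (k x) = k ((h^-1 ^+ n) x).
  exact: homeoX_semiconj.
have hN x : A x -> (h ^+ N.+1) x = x by move=> Ax; rewrite (hX _ _ Ax).2 h0N.
have AkA x y : A x -> A y -> x <> k y.
  by move=> Ax /kA[Eky _] xky; apply: (AE x); split=> //; rewrite xky.
exists s, (R `|` (k^-1)%g @^-1` R), (A `|` (k^-1)%g @^-1` A).
have Gs : G s by apply: subgroupM => //; apply: subgroupJ => //; exact: subgroupV.
split; split=> //; try by clopen_tac.
- apply: homeo_eq => x; rewrite homeo1.
  case: (pselect (A x)) => [Ax|Ax]; first by rewrite (sXA _ _ Ax).2 hN.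
  case: (pselect (A (k^-1 x))) => [Akx|Akx].
    rewrite -{1}(homeogK k x) (sXkA _ _ Akx).2 -{1}(hN _ Akx) homeoXK.
    by rewrite homeogK.
  by elim: (N.+1) => // n IH; rewrite homeoXS IH soff.
- by exists r; left.
- by move=> x Qx; apply: soff => Ax; apply: Qx; [left|right].
- exists e => -[Ae|Ake]; first exact: (AE1 e).
  by apply: (AE1 e) => //; rewrite -(kVfix e).
- by move=> x [/RA|/RA]; [left|right].
- move=> x [Ax|Akx].
    have [i [r' [leiN Rr' xr']]] := AR x Ax.
    exists (N.+1 - i)%N; first exact: leq_subr.
    left; rewrite (sXA _ _ Ax).2 xr' -(hX _ _ (RA _ Rr')).2.
    by rewrite -homeoXD subnK ?hN //; [exact: RA|lia].
  have [i [r' [leiN Rr' xr']]] := AR _ Akx.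
  exists i; first exact: leqW.
  right; rewrite -(homeogK k x) (sXkA _ _ Akx).2 mem_preim homeoKg xr'.
  by rewrite -(hX _ _ (RA _ Rr')).2 homeoXK.
move=> i j x y leiN lejN [Rx|Rx] [Ry|Ry].
- rewrite (sXA _ _ (RA _ Rx)).2 (sXA _ _ (RA _ Ry)).2.
  rewrite (hX _ _ (RA _ Rx)).2 (hX _ _ (RA _ Ry)).2; exact: h0R.
- rewrite (sXA _ _ (RA _ Rx)).2 -(homeogK k y) (sXkA _ _ (RA _ Ry)).2 => /AkA[].
    exact: (sXA _ _ (RA _ Rx)).1.
  exact: (sXkA _ _ (RA _ Ry)).1.
- rewrite (sXA _ _ (RA _ Ry)).2 -(homeogK k x) (sXkA _ _ (RA _ Rx)).2.
  move=> /esym /AkA[]; first exact: (sXA _ _ (RA _ Ry)).1.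
  exact: (sXkA _ _ (RA _ Rx)).1.
- rewrite -(homeogK k x) -(homeogK k y).
  rewrite (sXkA _ _ (RA _ Rx)).2 (sXkA _ _ (RA _ Ry)).2 => /homeo_inj eq.
  (* On the second copy the exponents count powers of [h^-1], which exchanges [i] and [j]. *)
  apply/esym; apply: (h0R j i _ _ lejN leiN Rx Ry).
  rewrite -!(hX _ _ (RA _ _)).2 //.
  rewrite -{1}(homeoXVK h i (k^-1 x)) eq -homeoXD addnC homeoXD homeoXVK.
  by [].
Qed.


(** * Small involutions and their commutators *)

Definition small_involution g := [/\ G g, g ^+ 2 = 1 & small_support g].

Lemma small_involutionJ u g : small_involution u -> G g -> small_involution (u ^ g).
Proof.
move=> [Gu u2 us] Gg; split; [exact: subgroupJ| |exact: small_supportJ].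
by rewrite -conjXg u2 conj1g.
Qed.

(** If all small involutions commuted, then, as they generate [G], the involution [s] would be
    central. But some element of [G] fixes [w] and moves [s w]. *)
Lemma noncommuting_involutions : exists u v,
  [/\ small_involution u, small_involution v & [~ u, v] <> 1].
Proof.
have [s [W [Q [[Gs s2 _ [w Ww] cQ] [sQ [z Qz] _ _ sW]]]]] := cycle 1.
have inv_s : small_involution s by split=> //; exists Q, z.
have s1 : s w <> w.
  by move=> sw; have := sW 0%N 1%N w w isT isT Ww Ww; rewrite expg1 expg0 sw => /(_ erefl).
apply: contrapT => comm.
have genI : generated small_involution = G.
  apply: simple_generated => //; [by move=> u []|exact: small_involutionJ|].
  by exists s => // s1'; apply: s1; rewrite s1'.
have sC g : G g -> s * g = g * s.
  rewrite -genI; suff: generated small_involution `<=` [set g | commute s g].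
    by move=> sub /sub.
  refine (generated_sub _ _).
    apply/subgroupP; split=> [|x y /= xs ys|x /= xs].
    - exact: commute1.
    - exact: commuteM.
    - exact: commuteV.
  move=> v inv_v; apply: contrapT => vs; apply: comm; exists s, v; split=> // sv.
  by apply: vs; apply/commgP/eqP.
have [U [cU Usw Uw]] := clopen_neq s1.
have [V [cV VU V0 Vsw _]] := clopen_shrink (s w) cU (ex_intro _ _ Usw).
have [v Vv] := V0.
have [|||||g Gg [gU gV]] := vigorousP cU (clopen_setD cU cV) cV.
- by move=> x [].
- by [].
- by exists v => [|[]]; first exact: VU.
- by exists (s w).
- exact: V0.
have /(congr1 (fun f : homeo T => f w)) := sC g Gg.
by rewrite !homeoM (gU w) // => eq; apply: (Vsw); rewrite -eq; apply: gV; split.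
Qed.

Definition commutators (us : seq (homeo T)) : set (homeo T) :=
  [set g | exists u v, [/\ u \in us, v \in us & g = [~ u, v]]].

(** Commutators of small involutions generate [G] by simplicity, and each of the finitely many
    generators of [G] involves only finitely many of them. *)
Lemma involutions_generate : finitely_generated G ->
  exists us, (forall u, u \in us -> small_involution u) /\
    G `<=` generated (commutators us).
Proof.
move=> [X /finite_seqP[xs ->] genX].
pose fam g := exists us, (forall u, u \in us -> small_involution u) /\
  generated (commutators us) g.
have catS us vs : generated (commutators us) `<=` generated (commutators (us ++ vs)) /\
    generated (commutators vs) `<=` generated (commutators (us ++ vs)).
  by split; apply: generatedS => g [u [v [us_u us_v ->]]];
    exists u, v; rewrite !mem_cat us_u us_v ?orbT.
have catI us vs : (forall u, u \in us -> small_involution u) ->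
    (forall u, u \in vs -> small_involution u) ->
    forall u, u \in us ++ vs -> small_involution u.
  by move=> usI vsI u; rewrite mem_cat => /orP[/usI|/vsI].
have famG : G `<=` fam.
  have <- : generated [set g | exists u v,
      [/\ small_involution u, small_involution v & g = [~ u, v]]] = G.
    apply: simple_generated => //.
    - by move=> _ [u [v [[Gu _ _] [Gv _ _] ->]]]; exact: subgroupR.
    - move=> _ g [u [v [Iu Iv ->]]] Gg; exists (u ^ g), (v ^ g).
      by rewrite conjRg; split=> //; exact: small_involutionJ.
    - have [u [v [Iu Iv uv]]] := noncommuting_involutions.
      by exists [~ u, v] => //; exists u, v.
  refine (generated_sub _ _).
    apply/subgroupP; split=> [|x y [us [usI xus]] [vs [vsI yvs]]|x [us [usI xus]]].
    - by exists [::]; split=> //; exact: (subgroup1 (subgroup_generated _)).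
    - exists (us ++ vs); split; first exact: catI.
      apply: (subgroupM (subgroup_generated _)); first exact: (catS us vs).1.
      exact: (catS us vs).2.
    - by exists us; split=> //; exact: (subgroupV (subgroup_generated _)).
  move=> _ [u [v [Iu Iv ->]]]; exists [:: u; v]; split.
    by move=> w; rewrite !inE => /orP[]/eqP->.
  by apply: sub_generated; exists u, v; rewrite !inE !eqxx orbT.
have [us [usI usX]] : exists us, (forall u, u \in us -> small_involution u) /\
    forall f, f \in xs -> generated (commutators us) f.
  have : forall f, f \in xs -> G f by move=> f xs_f; rewrite -genX; exact: sub_generated.
  elim: xs {genX} => [|f xs IH] xsG; first by exists [::].
  have [us [usI usX]] := IH (fun g gxs => xsG g (@mem_behead _ (f :: xs) g gxs)).
  have [vs [vsI vsx]] := famG f (xsG f (mem_head _ _)).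
  exists (us ++ vs); split; first exact: catI.
  move=> g; rewrite inE => /predU1P[->|/usX]; first exact: (catS us vs).2.
  exact: (catS us vs).1.
exists us; split=> //; rewrite -genX.
exact: (generated_sub (subgroup_generated _)).
Qed.

(** * Subgroups containing all small elements of a clopen set *)

(* Properness of [V] in [M] is what makes this closed under unions (see
   [absorbs_setU]) without showing that the group of elements supported in [M]
   is generated by those of proper support. *)
Definition absorbs (H : set (homeo T)) M := forall V g z,
  clopen V -> V `<=` M -> M z -> ~ V z -> G g -> supported V g -> H g.

Lemma absorbs_image H M l : is_subgroup H -> G l -> H l ->
  absorbs H M -> absorbs H ((l^-1)%g @^-1` M).
Proof.
move=> sH Gl Hl aM V g z cV VM Mz Vz Gg gV.
rewrite -(conjgKV l g); apply: subgroupJ => //.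
apply: (aM (l @^-1` V) _ (l^-1 z)) => //.
- by clopen_tac.
- by move=> x /VM; rewrite mem_preim homeoKg.
- by rewrite mem_preim homeogK.
- by apply: subgroupJ => //; exact: subgroupV.
- apply: supportedJ => x Vx; apply: gV => Vx'; apply: Vx.
  by rewrite !mem_preim homeogK.
Qed.

(** With the missed point [z] in [M1], an element [l] of [H] pushes [V] inside [M1] into the
    overlap. The conjugate of [g] by [l] is then supported in a proper part of [M2]. *)
Lemma absorbs_setU H M1 M2 : is_subgroup H -> clopen M1 -> clopen M2 ->
  M1 `&` M2 !=set0 -> absorbs H M1 -> absorbs H M2 -> absorbs H (M1 `|` M2).
Proof.
move=> sH cM1 cM2 M120 a1 a2 V g z cV VM Mz Vz Gg gV.
wlog M1z : M1 M2 cM1 cM2 M120 a1 a2 VM Mz / M1 z.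
  move=> IH; case: (Mz) => Mz'; first exact: (IH M1 M2).
  by apply: (IH M2 M1) => //; rewrite 1?setIC 1?setUC.
have [ O [cO OM O0 Oz [y2 [M1y2 M2y2] [Oy2 _]]]] :=
  clopen_shrink z (clopenI cM1 cM2) M120.
(* [Z] is kept out of the support of [l], so that [l] itself is absorbed by [M1]; [y] remains as the
   witness of properness in what is left. *)
have cZ0 : clopen (M1 `\` V `\` O) by clopen_tac.
have [|Z [cZ ZZ0 [z1 Zz1] _ [y [[M1y Vy] Oy] [Zy _]]]] := clopen_shrink z cZ0.
  by exists z.
have [|||||l Gl [lM lO]] :=
  vigorousP (clopen_setD cM1 cZ) (clopenI cV cM1) cO.
- by move=> x [Vx M1x]; split=> // /ZZ0 [[]].
- by move=> x Ox; split; [exact: (OM x Ox).1|move=> /ZZ0 []].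
- by exists y => // -[].
- by exists y.
- exact: O0.
have Hl : H l.
  apply: (a1 (M1 `\` Z) l z1) => //; [by clopen_tac| |].
    exact: (ZZ0 _ Zz1).1.1.
  by move=> [].
rewrite -(conjgK l g); apply: subgroupJ => //; last exact: subgroupV.
apply: (a2 (O `|` (V `\` M1)) _ y2) => //.
- by clopen_tac.
- by move=> x [/OM[]|[/VM[]]].
- by case=> [|[]].
- exact: subgroupJ.
- apply: supportedJ => x Ox; apply: gV => Vx; apply: Ox.
  rewrite mem_preim; case: (pselect (M1 x)) => M1x; first by left; exact: lO.
  by right; rewrite lM // => -[].
Qed.

Lemma absorbs_setT H : is_subgroup H -> absorbs H [set: T] -> G `<=` H.
Proof.
move=> sH aH; apply: small_support_generate => // g Gg [A [y [cA Ay gA]]].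
exact: (aH A g y).
Qed.

(** Consecutive translates of [B] overlap, in the translates of [s x], so they can be added one at a
    time. *)
Lemma absorbs_orbit H B s n x : is_subgroup H -> G s -> H s -> clopen B ->
  B x -> B (s x) -> absorbs H B ->
  absorbs H [set y | exists2 i, (i < n.+1)%N & B ((s ^+ i)^-1 y)].
Proof.
move=> sH Gs Hs cB Bx Bsx aB.
pose F i := ((s ^+ i)^-1)%g @^-1` B.
have cF i : clopen (F i) by clopen_tac.
have aF i : absorbs H (F i) by apply: absorbs_image => //; exact: subgroupX.
elim: n => [|n IH].
  suff -> : [set y | exists2 i, (i < 1)%N & F i y] = F 0%N by exact: aF.
  apply/seteqP; split=> y; last by exists 0%N.
  by move=> [i]; rewrite ltnS leqn0 => /eqP->.
suff -> : [set y | exists2 i, (i < n.+2)%N & F i y] =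
    [set y | exists2 i, (i < n.+1)%N & F i y] `|` F n.+1.
  apply: absorbs_setU => //; first exact: clopen_bounded.
  exists ((s ^+ n.+1) x); split; last by rewrite /F mem_preim homeoKg.
  by exists n => //; rewrite /F mem_preim homeoXSr homeoKg.
apply/seteqP; split=> y.
  move=> [i]; rewrite ltnS leq_eqVlt => /predU1P[->|ltin] Fy; first by right.
  by left; exists i.
by case=> [[i ltin Fy]|Fy]; [exists i => //; exact: ltnW|exists n.+1].
Qed.

(** * Copying the action of [G] into a clopen set *)

(* [phi] is a piecewise-[G] homeomorphism from the Cantor space onto the clopen
   subset [B]; it need not extend to an element of [G]. *)
Definition copy B (phi : T -> T) :=
  [/\ injective phi, forall z, B z <-> exists x, z = phi x,
    forall V, clopen V -> clopen (phi @^-1` V) &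
    forall A y, clopen A -> ~ A y -> exists2 h, G h & forall x, A x -> h x = phi x].

(** [phi] is the identity on [A] and, off [A], an element of [G] mapping the complement of [A] into
    [Z]. *)
Lemma exists_copy A Z : clopen A -> clopen Z -> A !=set0 -> Z !=set0 ->
  (forall x, A x -> Z x -> False) ->
  exists B phi, [/\ copy B phi, clopen B, A `<=` B, B `<=` A `|` Z & Z `&` B !=set0].
Proof.
move=> cA cZ [a Aa] [z Zz] AZ.
have [|||||g Gg [_ gZ]] := vigorousP (@clopenT T) (clopen_setC cA) cZ.
- by [].
- by [].
- by exists a => // /(_ Aa).
- by exists a => // /(AZ _ Aa).
- by exists z.
have Az : ~ A z by move=> /AZ /(_ Zz).
pose phi x := if pselect (A x) then x else g x.
have phiA x : A x -> phi x = x by rewrite /phi; case: pselect.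
have phiC x : ~ A x -> phi x = g x by rewrite /phi; case: pselect.
have gA x : ~ A x -> ~ A (g x) by move=> Ax Agx; exact: (AZ _ Agx (gZ _ Ax)).
exists (A `|` (g^-1)%g @^-1` (~` A)), phi; split=> //.
- split.
  + move=> x y; case: (pselect (A x)) => Ax; case: (pselect (A y)) => Ay;
      rewrite ?(phiA _ Ax) ?(phiA _ Ay) ?(phiC _ Ax) ?(phiC _ Ay) => // xy.
    * by move: Ax; rewrite xy => /gA.
    * by move: Ay; rewrite -xy => /gA.
    * exact: (homeo_inj xy).
  + move=> y; split=> [[Ay|Ay]|[x ->]]; first by exists y; rewrite phiA.
      by exists (g^-1 y); rewrite phiC // homeogK.
    case: (pselect (A x)) => Ax; first by left; rewrite phiA.
    by right; rewrite phiC // mem_preim homeoKg.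
  + move=> V cV; have -> : phi @^-1` V = (A `&` V) `|` (g @^-1` V `\` A).
      apply/seteqP; split=> x /=; case: (pselect (A x)) => Ax.
      - by rewrite phiA //; left.
      - by rewrite phiC //; right.
      - by rewrite phiA // => -[[]|[]].
      - by rewrite phiC // => -[[]|[]].
    by clopen_tac.
  (* The two pieces of [phi] are glued on [D] by extending [g] from the part of [D] off [A], with
     support off the part inside [A]. *)
  + move=> D y cD Dy.
    have cM : clopen (~` (D `&` A)) by clopen_tac.
    have [||||h [Gh hM hD]] := extend Gg cM (clopen_setD cD cA).
    * by move=> x [Dx Ax] [].
    * by move=> x [Dx Ax] [_]; exact: gA.
    * by exists y => -[].
    * case: (pselect (A y)) => Ay.
        exists y => [[]//|[_ Agy]]; apply: (gA _ Agy); by rewrite homeogK.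
      by exists (g y) => [[_ /gA]|] //; rewrite homeoKg => -[].
    exists h => // x Dx; case: (pselect (A x)) => Ax.
      by rewrite phiA // hM // => /(_ (conj Dx Ax)).
    by rewrite phiC // hD.
- by clopen_tac.
- move=> x [Ax|Ax]; first by left.
  by right; rewrite -(homeogK g x); apply: gZ.
- exists (g z); split; first exact: gZ.
  by right; change (~ A (g^-1 (g z))); rewrite homeoKg.
Qed.

Definition copies B (phi : T -> T) f g :=
  (forall y, g (phi y) = phi (f y)) /\ supported B g.

Lemma copy_small B phi f A y : copy B phi -> clopen A -> ~ A y -> supported A f ->
  exists2 h, G h & copies B phi f (f ^ h).
Proof.
move=> [phi_inj phiB _ ext] cA Ay fA; have [h Gh hA] := ext A y cA Ay.
exists h => //.
have phiA x : ~ A x -> ~ A (h^-1 (phi x)).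
  move=> Ax Ahx; apply: Ax; suff <- : h^-1 (phi x) = x by [].
  by apply: phi_inj; rewrite -hA // homeogK.
split=> [x|x Bx]; rewrite homeoJ.
  case: (pselect (A x)) => Ax.
    by rewrite -(hA _ Ax) homeoKg hA //; exact: supported_mem.
  by rewrite (fA _ (phiA _ Ax)) homeogK fA.
rewrite fA ?homeogK // => Ahx; apply: Bx; apply/phiB; exists (h^-1 x).
by rewrite -hA // homeogK.
Qed.

Lemma copiesM B phi f1 f2 g1 g2 :
  copies B phi f1 g1 -> copies B phi f2 g2 -> copies B phi (f1 * f2) (g1 * g2).
Proof.
move=> [g1phi g1B] [g2phi g2B].
by split=> [x|]; [rewrite !homeoM g1phi g2phi|exact: supportedM].
Qed.

Lemma copiesV B phi f g : copies B phi f g -> copies B phi f^-1 g^-1.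
Proof.
move=> [gphi gB]; split=> [x|]; last exact: supportedV.
by apply: (@homeo_inj _ g); rewrite gphi !homeogK.
Qed.

Lemma copiesR B phi f1 f2 g1 g2 :
  copies B phi f1 g1 -> copies B phi f2 g2 -> copies B phi [~ f1, f2] [~ g1, g2].
Proof.
move=> c1 c2; rewrite !commgEl !conjgE.
by do !apply: copiesM => //; exact: copiesV.
Qed.

Lemma subgroup_copies B phi H : is_subgroup H ->
  is_subgroup [set f | exists2 g, H g & copies B phi f g].
Proof.
move=> sH; apply/subgroupP; split.
- by exists 1; [exact: subgroup1|].
- move=> f1 f2 [g1 Hg1 c1] [g2 Hg2 c2].
  by exists (g1 * g2); [exact: subgroupM|exact: copiesM].
- by move=> f [g Hg c]; exists g^-1; [exact: subgroupV|exact: copiesV].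
Qed.

(** On the preimage of [V], which is proper, [phi] agrees with some [h] in [G]. So [g] is the copy
    of its conjugate by [h^-1], and a copy is determined by what it copies. *)
Lemma absorbs_copy B phi H : copy B phi -> (forall f, G f -> exists2 g, H g & copies B phi f g) ->
  absorbs H B.
Proof.
move=> [phi_inj phiB phiV ext] HB V g z cV VB Bz Vz Gg gV.
have [y zE] := (phiB z).1 Bz; subst z.
have [h Gh hA] := ext (phi @^-1` V) y (phiV _ cV) Vz.
have [|g' Hg' [g'phi g'B]] := HB (g ^ h^-1).
  by apply: subgroupJ => //; exact: subgroupV.
suff -> : g = g' by [].
apply: homeo_eq => x; case: (pselect (B x)) => [Bx|Bx]; last first.
  by rewrite g'B // gV // => /VB.
have [t ->] := (phiB x).1 Bx.
rewrite g'phi homeoJ invgK.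
case: (pselect (V (phi t))) => Vt.
  have Vgt := supported_mem gV Vt.
  have [t' gt] := (phiB _).1 (VB _ Vgt).
  have Vt' : V (phi t') by rewrite -gt.
  by rewrite hA // gt -{2}(hA t') // homeoKg.
rewrite (gV _ Vt) gV ?homeoKg // => Vht.
have [t' ht] := (phiB _).1 (VB _ Vht).
apply: Vt; suff <- : t' = t by rewrite -ht.
by apply: (@homeo_inj _ h); rewrite ht hA //= -ht.
Qed.


(** [t] is the product of the conjugates [x i ^ k i], whose supports lie in disjoint translates of
    [B]. *)
Lemma spread_product n (k x : nat -> homeo T) B :
  (forall i, G (k i)) -> (forall i, G (x i)) -> (forall i, supported B (x i)) ->
  (forall i j b c, (i < n)%N -> (j < n)%N -> B b -> B c -> k i b = k j c -> i = j) ->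
  exists t, [/\ G t, forall i b, (i < n)%N -> B b -> t (k i b) = k i (x i b) &
    forall z, (forall i b, (i < n)%N -> B b -> z <> k i b) -> t z = z].
Proof.
move=> Gk Gx xB; elim: n => [|n IH] kB; first by exists 1; split=> //; exact: subgroup1.
have [|t [Gt tk tfix]] := IH.
  by move=> i j b c ltin ltjn; apply: kB; exact: ltnW.
exists (t * x n ^ k n); split.
- by apply: subgroupM => //; exact: subgroupJ.
- move=> i b; rewrite ltnS leq_eqVlt homeoM => /predU1P[->|ltin] Bb.
    rewrite tfix ?homeoJ ?homeoKg // => j c ltjn Bc eq.
    by have := kB n j b c (leqnn _) (ltnW ltjn) Bb Bc eq; lia.
  rewrite tk // homeoJ xB ?homeogK // => Bk.
  have Bxb : B (x i b) by exact: supported_mem.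
  have := kB i n _ _ (ltnW ltin) (leqnn _) Bxb Bk.
  by rewrite homeogK => /(_ erefl); lia.
- move=> z zk; rewrite homeoM tfix => [|i b ltin]; last by apply: zk; exact: ltnW.
  rewrite homeoJ xB ?homeogK // => Bz.
  by apply: (zk n _ (leqnn _) Bz); rewrite homeogK.
Qed.

End Vigorous.

(** * Commutators of locally prescribed maps, and Sidon sets *)

Lemma commg_local (T : topologicalType) (B : set T) (f1 f2 x1 x2 : homeo T) :
  supported B x1 -> supported B x2 ->
  (forall z, B z -> f1 z = x1 z) -> (forall z, B z -> f2 z = x2 z) ->
  (forall z, ~ B z -> f1 z = z \/ f2 z = z) -> [~ f1, f2] = [~ x1, x2].
Proof.
move=> x1B x2B f1B f2B f12; apply: homeo_eq => z.
rewrite !commgEl !conjgE !homeoM.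
have VE (f x : homeo T) : supported B x -> (forall z, B z -> f z = x z) ->
    forall z, B z -> f^-1 z = x^-1 z.
  move=> xB fB y By; apply: (@homeo_inj _ f).
  by rewrite homeogK fB ?homeogK //; exact: supported_memV.
(* In [B] the maps agree with [x1] and [x2], which preserve [B]. Off [B], which is preserved too,
   one of [f1] and [f2] is the identity at each point, and the commutator cancels. *)
case: (pselect (B z)) => Bz.
  have B1 : B (x1^-1 z) by exact: supported_memV.
  have B2 : B (x2^-1 (x1^-1 z)) by exact: supported_memV.
  have B3 : B (x1 (x2^-1 (x1^-1 z))) by exact: supported_mem.
  by rewrite (VE f1 x1) // (VE f2 x2) // f1B // f2B.
rewrite (supportedV x1B) // (supportedV x2B) // x1B // x2B //.
have BV (f x : homeo T) : supported B x -> (forall z, B z -> f z = x z) -> ~ B (f^-1 z).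
  move=> xB fB Bfz; apply: Bz; rewrite -(homeogK f z) fB //.
  exact: supported_mem.
case: (pselect (f1 z = z)) => f1z.
  rewrite (homeoV_fix f1z).
  case: (f12 _ (BV f2 x2 x2B f2B)) => [->|f2V]; first by rewrite homeogK.
  move: (f2V); rewrite homeogK => /esym f2z.
  by rewrite f2z f1z -{1}f2z homeogK.
have f2z : f2 z = z by case: (f12 z Bz).
have : f2 (f1^-1 z) = f1^-1 z.
  case: (f12 _ (BV f1 x1 x1B f1B)) => // f1V.
  by case: f1z; move: (f1V); rewrite homeogK => {1}->; rewrite homeogK.
by move=> /homeoV_fix ->; rewrite homeogK f2z.
Qed.

Lemma expn3_lt a b : (a < b)%N -> (3 * 3 ^ a <= 3 ^ b)%N.
Proof. by rewrite -expnS leq_exp2l. Qed.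

(** Two powers of 3 are added without carry in base 3, so the digits of the sum reveal both
    exponents. *)
Lemma sidon_expn3 a b c d : (3 ^ a + 3 ^ b = 3 ^ c + 3 ^ d)%N ->
  a = c /\ b = d \/ a = d /\ b = c.
Proof.
have gt0 i : (0 < 3 ^ i)%N by rewrite expn_gt0.
have := (gt0 a, gt0 b, gt0 c, gt0 d).
case: (ltngtP a c) => [/expn3_lt|/expn3_lt|?];
case: (ltngtP a d) => [/expn3_lt|/expn3_lt|?];
case: (ltngtP b c) => [/expn3_lt|/expn3_lt|?];
case: (ltngtP b d) => [/expn3_lt|/expn3_lt|?]; subst; try lia; auto.
Qed.

Lemma commute_disjoint (T : topologicalType) (A : set T) (f g : homeo T) :
  supported A f -> supported (~` A) g -> commute f g.
Proof.
move=> fA gA; apply: homeo_eq => x; rewrite !homeoM.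
case: (pselect (A x)) => Ax.
  by rewrite !gA // => nA; apply: nA => //; exact: supported_mem.
by rewrite fA // fA //; exact: (supported_mem gA).
Qed.

(** * Generating [G] with one conjugate *)

Section Witness.
Local Notation T := cantor_space.
Variable G : set (homeo T).
Hypotheses (sG : is_subgroup G) (simG : simple_group G) (vigG : vigorous G).
Hypothesis fgG : finitely_generated G.

(** The order of [s] is made to divide an odd number, and [t] an involution, so that both can later
    be recovered as powers of a commuting product. *)
Lemma absorbing_pair : exists s t Q S N,
  [/\ [/\ G s, G t, t ^+ 2 = 1 & s ^+ (N.*2).+1 = 1],
      [/\ clopen Q, clopen S, supported Q s & supported S t],
      [/\ S `<=` Q, exists2 z, Q z & ~ S z & exists z, ~ Q z] &
    forall H, is_subgroup H -> H s -> H t -> absorbs G H Q].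
Proof.
have [us [usI Gus]] := involutions_generate sG simG vigG fgG.
(* Every position [2 * 3 ^ i] with [i < n] is at most [N / 3], so a sum of two positions, plus the
   offset 1 of [s W], does not wrap around the cycle of length [2N + 1]. *)
pose n := size us; pose N := (2 * 3 ^ n)%N.
have [s [W [Q [[Gs sN cW [w0 Ww0] cQ] [sQ [q Qq] WQ QW sW]]]]] :=
  cycle sG simG vigG N.*2.
have N0 : (0 < 3 ^ n)%N by rewrite expn_gt0.
pose Z := (s^-1)%g @^-1` W.
have cZ : clopen Z by clopen_tac.
have [|||B [phi [cphi cB WB BWZ [y0 [Wy0 By0]]]]] := exists_copy sG simG vigG cW cZ.
- by exists w0.
- by exists (s w0); rewrite /Z mem_preim homeoKg.
- move=> x Wx Zx; have := sW 1%N 0%N (s^-1 x) x.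
  rewrite expg1 expg0 homeogK => eq01.
  by have := eq01 ltac:(rewrite /N; lia) isT Zx Wx erefl.
have Bs b : B b -> exists e v, [/\ (e <= 1)%N, W v & b = (s ^+ e) v].
  move=> /BWZ[Wb|Zb]; first by exists 0%N, b.
  by exists 1%N, (s^-1 b); rewrite expg1 homeogK.
pose p i := (2 * 3 ^ i)%N.
have pN i : (i < n)%N -> (3 * p i <= N)%N.
  by move=> /expn3_lt; rewrite /p /N mulnCA leq_mul2l.
have p2 i : (2 <= p i)%N by rewrite /p -{1}(muln1 2) leq_mul2l expn_gt0.
(* [B] meets only the translates [W] and [s W], so translates of [B] by even
   powers of [s] are disjoint, and the positions [p i] form a Sidon set. *)
have sB i j b c : ~~ odd i -> ~~ odd j ->
    (i < N.*2)%N -> (j < N.*2)%N ->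
    B b -> B c -> (s ^+ i) b = (s ^+ j) c -> i = j.
  move=> ei ej iN jN /Bs[e [v [e1 Wv ->]]] /Bs[e' [v' [e'1 Wv' ->]]].
  rewrite -!homeoXD => /sW; move=> /(_ _ _ Wv Wv'); lia.
(* Beyond the list the default 1 is copied by 1, which makes [x] total. *)
have /choice[x xP] : forall i, exists x, [/\ G x, x ^+ 2 = 1 & copies B phi (nth 1 us i) x].
  move=> i; case: (ltnP i n) => [ltin|leni].
    have [Gu u2 [A [y [cA Ay uA]]]] := usI _ (mem_nth 1 ltin).
    have [h Gh uh] := copy_small cphi cA Ay uA.
    exists (nth 1 us i ^ h); split=> //; first exact: subgroupJ.
    by rewrite -conjXg u2 conj1g.
  rewrite nth_default //; exists 1; split; [exact: subgroup1|exact: expg1n|].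
  by split.
pose k i := s ^+ p i.
have [||||t [Gt tk tfix]] := @spread_product G sG n k x B.
- by move=> i; exact: subgroupX.
- by move=> i; have [] := xP i.
- by move=> i; have [_ _ []] := xP i.
- move=> i j b c /pN pi /pN pj Bb Bc eq.
  have : p i = p j.
    by apply: (sB _ _ _ _ _ _ _ _ Bb Bc eq); rewrite ?oddM //; move: (p2 i) (p2 j); lia.
  by move=> /eqP; rewrite eqn_mul2l /= eqn_exp2l // => /eqP.
have sQm y : Q y -> Q (s y) by exact: supported_mem.
have BQ : B `<=` Q.
  by move=> b /Bs[e [v [_ /WQ Qv ->]]]; exact: homeoX_mem.
have xB i b : B b -> B (x i b) by move=> Bb; have [_ _ [_ xB]] := xP i; exact: supported_mem.
pose S := [set z | exists2 i, (i < n)%N & B ((k i)^-1 z)].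
have SE z : S z <-> exists i b, [/\ (i < n)%N, B b & z = k i b].
  split=> [[i ltin Bz]|[i [b [ltin Bb ->]]]]; last by exists i; rewrite ?homeoKg.
  by exists i, ((k i)^-1 z); rewrite homeogK.
have tS : supported S t.
  by move=> z Sz; apply: tfix => i b ltin Bb zE; apply: Sz; apply/SE; exists i, b.
exists s, t, Q, S, N; split.
- split=> //; apply: homeo_eq => z; rewrite homeo1 homeoXS expg1.
  case: (pselect (S z)) => [/SE[i [b [ltin Bb ->]]]|Sz]; last by rewrite !tS.
  have [_ x2 _] := xP i.
  rewrite !tk //; last exact: xB.
  by rewrite -[x i (x i b)]/((x i ^+ 2) b) x2.
- split=> //; apply: (clopen_bounded (F := fun i => ((k i)^-1)%g @^-1` B)).
  by move=> i; clopen_tac.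
- split; last by exists q.
    by move=> z /SE[i [b [_ /BQ Qb ->]]]; exact: homeoX_mem.
  (* [S] misses [W], because all positions are at least 2. *)
  exists w0; first exact: WQ.
  move=> /SE[i [b [/pN pi /Bs[e [v [e1 Wv ->]]] w0E]]].
  have := sW 0%N (p i + e)%N w0 v; rewrite expg0 homeoXD => /(_ _ _ Ww0 Wv w0E).
  by move: (p2 i); lia.
move=> H sH Hs Ht.
(* This brings the [i]-th block of [t] back to [B], where [u i] acts as [x i]. *)
pose u i := t ^ (k i)^-1.
have Hu i : H (u i).
  by apply: subgroupJ => //; apply: subgroupV => //; exact: subgroupX.
have uE i z : u i z = (k i)^-1 (t (k i z)) by rewrite homeoJ invgK.
have uB i b : (i < n)%N -> B b -> u i b = x i b.
  by move=> ltin Bb; rewrite uE tk // homeoKg.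
have moved i z : u i z <> z -> exists l b, [/\ (l < n)%N, B b & k i z = k l b].
  move=> uz; apply/SE; apply: contrapT => Sz.
  by apply: uz; rewrite uE tS // homeoKg.
have uR i j : (i < n)%N -> (j < n)%N -> H [~ x i, x j].
  move=> ltin ltjn; case: (eqVneq i j) => [->|neij].
    by rewrite (_ : [~ x j, x j] = 1); [exact: subgroup1|exact/eqP/commgP].
  have [_ _ [_ xiB]] := xP i; have [_ _ [_ xjB]] := xP j.
  rewrite -(@commg_local _ B (u i) (u j)) //; first exact: subgroupR.
  - by move=> z; exact: uB.
  - by move=> z; exact: uB.
  move=> z Bz; case: (pselect (u i z = z)) => [|/moved[l [b [ltln Bb zb]]]]; first by left.
  case: (pselect (u j z = z)) => [|/moved[m [c [ltmn Bc zc]]]]; first by right.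
  (* If [u i] and [u j] both move [z], the Sidon property forces [j = i] or [l = i]; the latter puts
     [z] in [B]. *)
  exfalso; have eq : (s ^+ (p j + p l)) b = (s ^+ (p i + p m)) c.
    rewrite (homeoXD s (p j) (p l)) (homeoXD s (p i) (p m)).
    by rewrite -/(k l b) -zb -/(k m c) -zc -!homeoXD addnC.
  have := pN _ ltin; have := pN _ ltjn; have := pN _ ltln; have := pN _ ltmn.
  move=> pm pl pj pi.
  have : (p j + p l = p i + p m)%N.
    by apply: (sB _ _ _ _ _ _ _ _ Bb Bc eq); rewrite ?oddD ?oddM //; move: (p2 i) (p2 j); lia.
  rewrite /p -!mulnDr => /eqP; rewrite eqn_mul2l /= => /eqP /sidon_expn3.
  case=> [[ji _]|[_ li]]; first by rewrite ji eqxx in neij.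
  by apply: Bz; subst l; rewrite (homeo_inj zb).
have aB : absorbs G H B.
  apply: (absorbs_copy sG cphi) => f Gf.
  suff sub : commutators us `<=` [set h | exists2 h', H h' & copies B phi h h'].
    exact: (generated_sub (subgroup_copies B phi sH) sub (Gus f Gf)).
  move=> _ [u1 [u2 [us_u1 us_u2 ->]]].
  exists [~ x (index u1 us), x (index u2 us)]; first by apply: uR; rewrite index_mem.
  have [_ _ c1] := xP (index u1 us); have [_ _ c2] := xP (index u2 us).
  by rewrite !nth_index // in c1 c2; exact: copiesR.
(* The point [s^-1 y0] lies in [W], hence in [B], and [s] sends it to [y0], also in [B]. The
   translates of [B] by powers of [s] then fill [Q]. *)
have := absorbs_orbit sG vigG (n := (N.*2).+1) sH Gs Hs cB (WB _ Wy0).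
rewrite homeogK => /(_ By0 aB); congr absorbs.
apply/seteqP; split=> y.
  move=> [i _ By]; rewrite -(homeogK (s ^+ i) y).
  by apply: homeoX_mem => //; exact: BQ.
move=> /QW[i leiN Wy]; exists ((N.*2).+1 - i)%N; first by rewrite ltnS leq_subr.
apply: WB; congr (W _): Wy; apply: (@homeo_inj _ (s ^+ ((N.*2).+1 - i))).
by rewrite homeogK -homeoXD subnK // sN.
Qed.

Lemma spread_witness : uniform_spread_witness G 1.
Proof.
have [s [t [Q [S [N [[Gs Gt t2 sN] [cQ cS sQ tS] [SQ [q Qq Sq] [p Qp]] HQ]]]]]] :=
  absorbing_pair.
have [ O [cO OQ [ o Oo] _ [z Qz [Oz _]]]] := clopen_shrink point cQ (ex_intro _ q Qq).
have cP := clopen_setC cQ.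
have [|||||f Gf [_ fO]] := vigorousP sG vigG (@clopenT _) cP cO.
- by [].
- by [].
- by exists q => // /(_ Qq).
- by exists z.
- by exists o.
have cfP : clopen ((f^-1)%g @^-1` (~` Q)) by clopen_tac.
have fPO : (f^-1)%g @^-1` (~` Q) `<=` O.
  by move=> x /fO; rewrite homeogK.
have [||||b Gb [bQ bS]] := vigorousP sG vigG cQ cS cfP SQ.
- exact: subset_trans fPO OQ.
- by exists q.
- by exists z => // /fPO.
- by exists (f p); change (~ Q (f^-1 (f p))); rewrite homeoKg.
pose g := f * b^-1.
have Gg : G g by apply: subgroupM => //; exact: subgroupV.
have gP x : ~ Q x -> Q (g x).
  by move=> /fO /OQ Qfx; rewrite homeoM; exact: supported_memV.
have Sg y : S y -> ~ Q (g^-1 y).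
  by move=> /bS; rewrite /g invgM invgK.
(* The image under [g] of the complement of [Q] does not exhaust [Q]. The point [z'] gives room for
   the extension [d], and later an overlap of two absorbed sets. *)
have [z' Qz' gz'] : exists2 z', Q z' & Q (g^-1 z').
  exists (b^-1 z); first exact: supported_memV.
  rewrite /g invgM invgK homeoM homeogK; apply: contrapT => Qfz.
  by apply: Oz; exact: fPO.
pose s1 := t ^ g^-1.
have s1E x : s1 x = g^-1 (t (g x)) by rewrite homeoJ invgK.
have Gs1 : G s1 by apply: subgroupJ => //; exact: subgroupV.
have s1P : supported (~` Q) s1.
  move=> x Qx; rewrite s1E tS ?homeoKg // => /Sg; rewrite homeoKg.
  by move=> /Qx.
have comm : commute s1 s.
  by apply: (commute_disjoint (A := ~` Q)) => //; rewrite setCK.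
(* The odd exponent kills [s] and leaves the involution [s1]. *)
have s1X : (s1 * s) ^+ (N.*2).+1 = s1.
  rewrite expgMn // sN mulg1 expgS -mul2n expgnA.
  by rewrite -conjXg t2 conj1g expg1n mulg1.
exists (s1 * s); first exact: subgroupM.
move=> a /(_ ord0) [Ga a1]; set a0 := a ord0 in Ga a1.
have [x ax] : exists x, a0 x <> x.
  apply: contrapT => nx; apply: a1; apply: homeo_eq => x.
  by apply: contrapT => ax; apply: nx; exists x.
have [V [cV Vax Vx]] := clopen_neq ax.
pose U := a0 @^-1` V `\` V.
have cU : clopen U by rewrite /U; clopen_tac.
have aU y : U y -> ~ U (a0 y) by move=> [Vy _] [_].
have [|U0 [cU0 U0U [u U0u] _ [y Uy [U0y _]]]] := clopen_shrink point cU.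
  by exists x.
have [|||||c Gc [_ cPU0]] := vigorousP sG vigG (@clopenT _) cP cU0.
- by [].
- by [].
- by exists q => // /(_ Qq).
- by exists y.
- by exists u.
pose a1' := a0 ^ c^-1.
have a1E v : a1' v = c^-1 (a0 (c v)) by rewrite homeoJ invgK.
have Ga1 : G a1' by apply: subgroupJ => //; exact: subgroupV.
have a1P v : ~ Q v -> Q (a1' v).
  move=> Qv; apply: contrapT => /cPU0 /U0U; rewrite a1E homeogK.
  by apply: aU; apply/U0U/cPU0.
have cD : clopen ((a1'^-1)%g @^-1` (~` Q)) by clopen_tac.
have Ga1g : G (a1'^-1 * g) by apply: subgroupM => //; exact: subgroupV.
(* [d] fixes the complement of [Q] and turns [a1'] into [g] there. The free point [c^-1 y] comes
   from [y] in [U] outside [U0]: [y] is not an image under [a0] of a point of [U]. *)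
have [||||d [Gd dQ dD]] := extend sG simG vigG Ga1g cQ cD.
- by move=> v /a1P; rewrite homeogK.
- by move=> v Dv; rewrite homeoM; exact: gP.
- exists (c^-1 y).
    by apply: contrapT => /cPU0; rewrite homeogK.
  move=> Dy; apply: (aU (c (a1'^-1 (c^-1 y)))); first exact/U0U/cPU0.
  have -> : a0 (c (a1'^-1 (c^-1 y))) = y; last exact: Uy.
  by apply: (@homeo_inj _ c^-1); rewrite -a1E homeogK.
- exists z' => //; rewrite mem_preim.
  have VK (h1 h2 : homeo cantor_space) v : h1^-1 ((h1^-1 * h2)^-1 v) = h2^-1 v.
    by rewrite invgM invgK homeoM homeoKg.
  by rewrite VK => /(_ gz').
pose a2 := a1' ^ d.
have a2P v : ~ Q v -> a2 v = g v.
  move=> Qv; have -> : a2 v = d (a1' (d^-1 v)) by exact: homeoJ.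
  rewrite (supportedV dQ Qv) dD; first by rewrite homeoM homeoKg.
  by change (~ Q (a1'^-1 (a1' v))); rewrite homeoKg.
(* The given [a0] must stay as it is, so the conjugation taking it to [a2] is transferred, inverted,
   to [s1 * s]. *)
pose e := (c^-1 * d)^-1.
have Ge : G e by do ![apply: subgroupV => //|apply: subgroupM => //].
exists ((s1 * s) ^ e); first by exists e.
move=> i; rewrite (ord1 i) -/a0; set K := generated _.
have sK : is_subgroup K by exact: subgroup_generated.
apply/seteqP; split.
  apply: generated_sub => // h [->|->] //.
  by apply: subgroupJ => //; exact: subgroupM.
pose H := [set h | K (h ^ e)].
have sH : is_subgroup H.
  apply/subgroupP; split=> [|h1 h2 /= K1 K2|h /= Kh].
  - by rewrite /H /= conj1g; exact: (subgroup1 sK).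
  - by rewrite /H /= conjMg; exact: (subgroupM sK).
  - by rewrite /H /= conjVg; exact: (subgroupV sK).
have Hss : H (s1 * s) by apply: sub_generated; right.
have Ha2 : H a2.
  rewrite /H /= /a2 /a1' -conjgM /e conjgK.
  by apply: sub_generated; left.
have Hs1 : H s1 by rewrite -s1X; exact: (subgroupX _ sH).
have Hs : H s.
  by rewrite -(mulKg s1 s); exact: (subgroupM sH (subgroupV sH Hs1)).
have Ht : H t.
  (* [s1] is supported where [a2] agrees with [g], so conjugating by [a2] undoes the conjugation by
     [g^-1]. *)
  suff -> : t = s1 ^ a2 by exact: (subgroupJ sH).
  apply: homeo_eq => v; rewrite homeoJ -{1}(homeogK a2 v).
  move: (a2^-1 v) => r; case: (pselect (Q r)) => Qr.
    rewrite s1P ?tS // => /Sg Qar.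
    apply: (Qar); suff <- : r = g^-1 (a2 r) by [].
    by apply: (@homeo_inj _ a2); rewrite (a2P _ Qar) homeogK.
  rewrite a2P // a2P ?s1E ?homeogK //.
  by rewrite -s1E; exact: (supported_mem s1P).
have aQ := HQ H sH Hs Ht.
have aQ2 : absorbs G H (a2 @^-1` Q).
  rewrite -(invgK a2); apply: absorbs_image => //.
    by apply: subgroupV => //; exact: subgroupJ.
  exact: (subgroupV sH).
have aT : absorbs G H [set: _].
  have -> : [set: cantor_space] = Q `|` a2 @^-1` Q.
    apply/esym/seteqP; split=> // v _; case: (pselect (Q v)) => Qv; first by left.
    by right; rewrite mem_preim a2P //; exact: gP.
  apply: absorbs_setU => //; first by clopen_tac.
  (* Were this point outside [Q], it would equal [g^-1 z'], which lies in [Q]. *)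
  exists (a2^-1 z'); split; last by rewrite mem_preim homeogK.
  apply: contrapT => Qa; have := a2P _ Qa; rewrite homeogK => zE.
  by apply: Qa; move: gz'; rewrite {1}zE homeoKg.
move=> h Gh; rewrite -(conjgKV e h).
apply: (absorbs_setT sG simG vigG sH aT); apply: subgroupJ => //.
exact: subgroupV.
Qed.

End Witness.

Theorem corollary12 (R : realType) (G : set (homeo cantor_space)) :
  is_subgroup G -> finitely_generated G -> simple_group G -> vigorous G ->
  (1 <= uniform_spread R G)%E.
Proof.
move=> sG fgG simG vigG; apply: ereal_sup_ubound.
by exists 1%N => //; exact: spread_witness.
Qed.
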